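(* Let $(X,d)$ be a metric space, let $A \subset X$ be a nonempty finite set, and let $\bar x \in X$. Define $f_{A,\bar x} \colon X \to \mathbb{R}$ by $f_{A,\bar x}(x) = \frac{1}{2}\max_{a \in A}\{ d(a,x)^2 - d(a,\bar x)^2 \}$. Then $\bar x$ is $A$-minimal if and only if $\bar x$ minimizes $f_{A,\bar x}$ over $X$, and $\bar x$ is strongly $A$-minimal if and only if $\bar x$ is the unique minimizer of $f_{A,\bar x}$ over $X$.
   Context: For a nonempty finite set $A$ in a metric space $(X,d)$: a point $\bar x \in X$ is $A$-minimal if no point $x \in X$ satisfies $d(a,x) < d(a,\bar x)$ for all $a \in A$. A point $\bar x$ is strongly $A$-minimal if no point $x \ne \bar x$ in $X$ satisfies $d(a,x) \le d(a,\bar x)$ for all $a \in A$. *)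

(* Defs.v *)
From HB Require Import structures.
From mathcomp Require Import all_boot all_order all_algebra finmap.
From mathcomp Require Import all_classical all_reals all_analysis.

Set Implicit Arguments.
Unset Strict Implicit.
Unset Printing Implicit Defensive.

Import Order.TTheory GRing.Theory Num.Theory.

Local Open Scope ring_scope.

Definition A_minimal (R : realType) (X : metricType R) (A : {fset X})
    (xbar : X) : Prop :=
  ~ exists x : X, forall a : X, a \in A -> mdist a x < mdist a xbar.

Definition strongly_A_minimal (R : realType) (X : metricType R)
    (A : {fset X}) (xbar : X) : Prop :=
  ~ exists x : X,
      x <> xbar /\ forall a : X, a \in A -> mdist a x <= mdist a xbar.

(* The maximum is taken in the extended reals, where -oo is neutral for maxe;
   for nonempty A it is a real number, so that fine only changes its type.
   (Starting the iteration at 0 instead would give the positive part of the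
   maximum.) *)
Definition f_A (R : realType) (X : metricType R) (A : {fset X})
    (xbar : X) (x : X) : R :=
  2^-1 * fine (\big[maxe/-oo%E]_(a <- A)
                 (mdist a x ^+ 2 - mdist a xbar ^+ 2)%:E).

Definition minimizer (R : realType) (X : Type) (f : X -> R) (x : X) : Prop :=
  forall y : X, f x <= f y.

Definition unique_minimizer (R : realType) (X : Type) (f : X -> R) (x : X)
  : Prop :=
  minimizer f x /\ forall y : X, minimizer f y -> y = x.

(* Main.v *)
(* Since d is nonnegative, f_A(x) <= 0 (resp. f_A(x) < 0) holds exactly when
   d(a,x) <= d(a,xbar) (resp. d(a,x) < d(a,xbar)) for all a in A.  As
   f_A(xbar) = 0, both equivalences follow. *)
Require Import Defs.
From mathcomp Require Import all_boot all_order all_algebra finmap.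
From mathcomp Require Import all_classical all_reals all_analysis.
Import Order.TTheory GRing.Theory Num.Theory.

Local Open Scope ring_scope.

(** Squaring is monotone on distances, so the sign of [f_A] at [x] records whether [x] is weakly
    ([f_A_le0]) or strictly ([f_A_lt0]) closer than [xbar] to all of [A]; the value at [xbar] is 0
    ([f_A_center]). Thus [A]-minimality says that [f_A] is nowhere negative, and strong
    [A]-minimality that it is positive away from [xbar]. *)

(** Lets [fineK] remove the [fine] in [f_A], so that signs can be read off the extended maximum. *)
Lemma bigmaxe_fset_fin_num (R : realType) (K : choiceType) (A : {fset K})
    (F : K -> R) :
  A != fset0 -> \big[maxe/-oo%E]_(a <- A) (F a)%:E \is a fin_num.
Proof.
move=> /fset0Pn[a aA].
by have := bigmaxe_fin_num (map_f F aA); rewrite big_map.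
Qed.

Lemma f_A_le0 (R : realType) (X : metricType R) (A : {fset X}) (xbar x : X) :
  A != fset0 ->
  f_A A xbar x <= 0 <-> forall a, a \in A -> mdist a x <= mdist a xbar.
Proof.
move=> A_neq0; rewrite /f_A pmulr_rle0 ?invr_gt0// -lee_fin.
rewrite fineK ?bigmaxe_fset_fin_num//.
split=> [le0 a aA|le0].
  have := le_trans (le_bigmax_seq _ _ _ _ aA isT) le0.
  by rewrite lee_fin subr_le0 ler_sqr ?nnegrE ?mdist_ge0.
(* [big_seq] keeps [a \in A] available for each term; the initial value [-oo] is trivially below
   0. *)
rewrite big_seq; apply: bigmax_le => [|a aA]; first exact: leNye.
by rewrite lee_fin subr_le0 ler_sqr ?nnegrE ?mdist_ge0 ?le0.
Qed.

Lemma f_A_lt0 (R : realType) (X : metricType R) (A : {fset X}) (xbar x : X) :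
  A != fset0 ->
  f_A A xbar x < 0 <-> forall a, a \in A -> mdist a x < mdist a xbar.
Proof.
move=> A_neq0; rewrite /f_A pmulr_rlt0 ?invr_gt0// -lte_fin.
rewrite fineK ?bigmaxe_fset_fin_num//.
split=> [lt0 a aA|lt0].
  have := le_lt_trans (le_bigmax_seq _ _ _ _ aA isT) lt0.
  by rewrite lte_fin subr_lt0 ltr_sqr ?nnegrE ?mdist_ge0.
rewrite big_seq; apply: bigmax_lt => [|a aA]; first exact: ltNyr.
by rewrite lte_fin subr_lt0 ltr_sqr ?nnegrE ?mdist_ge0 ?lt0.
Qed.

Lemma f_A_center (R : realType) (X : metricType R) (A : {fset X}) (xbar : X) :
  A != fset0 -> f_A A xbar xbar = 0.
Proof.
move=> A_neq0; apply/le_anti/andP; split; first exact/f_A_le0.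
(* A negative value would make [xbar] strictly closer than itself to some point of [A]. *)
rewrite leNgt; apply/negP => /(f_A_lt0 _ _ _ _ _ A_neq0) lt0.
by have /fset0Pn[a /lt0] := A_neq0; rewrite ltxx.
Qed.

Theorem proposition2p4 (R : realType) (X : metricType R) (A : {fset X})
    (A_neq0 : A != fset0) (xbar : X) :
  (A_minimal A xbar <-> minimizer (f_A A xbar) xbar) /\
  (strongly_A_minimal A xbar <-> unique_minimizer (f_A A xbar) xbar).
Proof.
have f0 := f_A_center R X A xbar A_neq0.
have fle0 x := f_A_le0 R X A xbar x A_neq0.
have flt0 x := f_A_lt0 R X A xbar x A_neq0.
split; split.
- move=> Amin x; rewrite f0 leNgt; apply/negP => /flt0 ltx.
  by apply: Amin; exists x.
- by move=> fmin [x /flt0]; rewrite ltNge -f0 fmin.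
- move=> Amin.
  have uniq x : f_A A xbar x <= 0 -> x = xbar.
    move=> /fle0 lex.
    by apply: contrapT => xneq; apply: Amin; exists x.
  split=> [x|x xmin]; last by apply: uniq; rewrite -f0.
  rewrite f0 leNgt; apply/negP => fx.
  by move: (fx); rewrite (uniq x (ltW fx)) f0 ltxx.
- move=> [fmin funiq] [x [xneq /fle0 fx]].
  (* A point with value at most 0, the minimum attained at [xbar], is itself a minimizer. *)
  by apply/xneq/funiq => y; rewrite (le_trans fx)// -f0.
Qed.
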